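(* For every $n \geqslant 2$ there exists a 2DFA with $n$ states which accepts at least one string and whose shortest accepted string has length exactly $3 \cdot 2^{n-2} - 1$.
   Context: A two-way deterministic finite automaton (2DFA) is a quintuple $(\Sigma, Q, q_0, \delta, F)$ where $\Sigma$ is a finite alphabet not containing the end-markers $\vdash$ and $\dashv$, $Q$ is a finite set of states, $q_0 \in Q$ is the initial state, $\delta: Q \times (\Sigma \cup \{\vdash, \dashv\}) \to Q \times \{-1,+1\}$ is a partial transition function, and $F \subseteq Q$ is the set of accepting states. On input $w = a_1 \cdots a_m \in \Sigma^*$ the automaton works on the tape $\vdash a_1 \cdots a_m \dashv$, starting at $\vdash$ in state $q_0$; in state $q$ reading symbol $c$, if $\delta(q,c) = (r,d)$ it enters state $r$ and moves one cell in direction $d$ ($-1$ left, $+1$ right); if $\delta(q,c)$ is undefined it rejects. It accepts $w$ if it ever arrives at $\dashv$ in a state from $F$; it may also loop forever (not accepting). The number of states of the automaton is $|Q|$. *)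

(* Defs.v *)
From mathcomp Require Import all_boot.
Set Implicit Arguments. Unset Strict Implicit. Unset Printing Implicit Defensive.

Inductive tsym (Sigma : Type) := LEnd | Sym of Sigma | REnd.
Arguments LEnd {Sigma}. Arguments REnd {Sigma}.

Inductive dir := Left | Right.

Record twoDFA (Sigma : finType) := TwoDFA {
  state : finType;
  q0 : state;
  delta : state -> tsym Sigma -> option (state * dir);
  final : pred state
}.

(* Tape  |- a_1 ... a_m -| : cell 0 is |-, cell i (1<=i<=m) is a_i,
   cell m+1 is -|. *)
Definition tape_at (Sigma : Type) (w : seq Sigma) (i : nat) : tsym Sigma :=
  match i with
  | 0 => LEnd
  | j.+1 => match nth None (map Some w) j with Some a => Sym a | None => REnd end
  end.

Definition step (Sigma : finType) (A : twoDFA Sigma) (w : seq Sigma)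
    (c : state A * nat) : option (state A * nat) :=
  let: (q, i) := c in
  match delta q (tape_at w i) with
  | None => None
  | Some (r, Left) => if i is i'.+1 then Some (r, i') else None
  | Some (r, Right) => if i < (size w).+1 then Some (r, i.+1) else None
  end.

Definition run (Sigma : finType) (A : twoDFA Sigma) (w : seq Sigma) (k : nat)
    : option (state A * nat) :=
  iter k (fun oc => match oc with Some c => @step Sigma A w c | None => None end)
       (Some (q0 A, 0)).

Definition accepts (Sigma : finType) (A : twoDFA Sigma) (w : seq Sigma) : Prop :=
  exists k q, @run Sigma A w k = Some (q, (size w).+1) /\ @final Sigma A q.

Definition nstates (Sigma : finType) (A : twoDFA Sigma) : nat := #|state A|.

(* Main.v *)
Require Import Defs.
From mathcomp Require Import all_boot zify.
Set Implicit Arguments. Unset Strict Implicit. Unset Printing Implicit Defensive.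

(* Put n = M + 2 and let 0, ..., M + 1 be the states. At the boundary between two
   cells, let P and R be the sets of states in which the run crosses it rightwards
   and leftwards; |P| = |R| + 1. On the shortest string, P and R alternate: they
   are {u_1, u_3, ...} and {u_2, u_4, ...} for u_1 < u_2 < ... < u_(2m+1), where
   only the last two may coincide, and then are equal to M + 1. There are
   3 * 2^M such sequences. With the order in which u precedes v if it is a proper
   prefix of v or if, at the first difference, u_i < v_i (i odd) or u_i > v_i
   (i even), each letter leads from one sequence to the next one.

   No shorter string is accepted because of a potential of (P, R). The digit at
   y < M is 1 + |{r in R, r <= y}| - |{p in P, p <= y}|, cut off at 0; these
   digits, read in base 2 with weight 2^(M-1-y), are the main part of the
   potential, and a number in {0, 1, 2} depending on whether M + 1 is in P and in
   R refines it. A letter can increase it by at most 1, since creating a digit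
   1 clears all lower digits, and it has to go from 0 to 3 * 2^M - 1. *)

(** * Crossing sets on the two sides of one cell *)

Definition exits_side (S : finType) (mv : S -> option (S * dir)) (d : bool) (q : S) : bool :=
  match mv q, d with
  | Some (_, Right), true | Some (_, Left), false => true
  | _, _ => false
  end.

Definition target (S : finType) (mv : S -> option (S * dir)) (q : S) : S :=
  if mv q is Some (r, _) then r else q.

(* One cell in a loop-free run: P and R are the sets of states in which the run
   crosses the left border of the cell rightwards and leftwards, P' and R' those
   of its right border, so that P :|: R' is the set of states visited in the cell. *)
Definition crossing_step (S : finType) (mv : S -> option (S * dir))
    (P R P' R' : {set S}) : Prop :=
  [/\ [disjoint P & R'],
      {in P :|: R' &, injective mv},
      {in P :|: R', forall q, mv q},
      R = target mv @: [set q in P :|: R' | exits_side mv false q] &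
      P' = target mv @: [set q in P :|: R' | exits_side mv true q]].

Section CrossingCount.
Variables (S : finType) (mv : S -> option (S * dir)) (P R P' R' : {set S}).
Hypothesis step_PR : crossing_step mv P R P' R'.

(** Two states that leave on the same side with the same target have the same value of [mv], so
    [target mv] inherits injectivity on each side. *)
Lemma card_exits_side d (Q : pred S) :
  #|[set r in target mv @: [set q in P :|: R' | exits_side mv d q] | Q r]|
  = #|[set q in P :|: R' | exits_side mv d q && Q (target mv q)]|.
Proof.
case: step_PR => _ inj_mv _ _ _.
set D := [set q in P :|: R' | _ && _].
have inj : {in D &, injective (target mv)}.
  move=> q1 q2 /setIdP[D1 /andP[g1 _]] /setIdP[D2 /andP[g2 _]] e.
  apply: inj_mv => //; move: g1 g2 e; rewrite /exits_side /target.
  by case: (d) (mv q1) (mv q2) => -[[? []]|] // [[? []]|] //= _ _ ->.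
rewrite -(card_in_imset inj); congr #|pred_of_set _|.
apply/setP => r; apply/setIdP/imsetP.
  by case=> /imsetP[q /setIdP[Dq gq] -> Qq]; exists q; rewrite // !in_set gq -in_setU Dq.
case=> q /setIdP[Dq /andP[gq Qq]] ->; split=> //.
by rewrite imset_f // in_set Dq.
Qed.

(** Together with [crossing_step_in], which counts the same visits by the state before the move,
    this governs how a digit changes from one border to the other. *)
Lemma crossing_step_out (Q : pred S) :
  #|[set r in R | Q r]| + #|[set p in P' | Q p]|
  = #|[set q in P :|: R' | Q (target mv q)]|.
Proof.
have [_ _ def_mv defR defP'] := step_PR.
rewrite {1}defR {1}defP' !card_exits_side.
set DL := [set q in _ | _]; set DR := [set q in _ | _].
have dLR : [disjoint DL & DR].
  rewrite -setI_eq0; apply/eqP/setP => q; rewrite !inE /exits_side.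
  by case: (mv q) => [[? []]|]; rewrite ?andbF.
have /eqP <- : #|DL :|: DR| == #|DL| + #|DR| by rewrite (leq_card_setU DL DR).2.
apply: eq_card => q; rewrite !inE -!andb_orr.
have := def_mv q; rewrite inE.
case: (_ || _) => //= /(_ isT); rewrite /exits_side.
by case: (mv q) => [[? []]|] //; rewrite /= ?orbF.
Qed.

Lemma crossing_step_in (Q : pred S) :
  #|[set r in P | Q r]| + #|[set p in R' | Q p]| = #|[set q in P :|: R' | Q q]|.
Proof.
case: step_PR => dPR _ _ _ _.
have -> : [set q in P :|: R' | Q q] = [set r in P | Q r] :|: [set p in R' | Q p].
  by apply/setP => q; rewrite !inE andb_orl.
apply/esym/eqP; rewrite (leq_card_setU _ _).2.
apply: disjointWl (disjointWr _ dPR); apply/subsetP => q; rewrite inE; by case/andP.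
Qed.

Lemma crossing_step_balance : #|P| = #|R|.+1 -> #|P'| = #|R'|.+1.
Proof.
have setT2 (B : {set S}) : [set q in B | predT q] = B by apply/setP=> q; rewrite inE andbT.
have := crossing_step_out predT; have := crossing_step_in predT.
rewrite !setT2; lia.
Qed.

End CrossingCount.

(** * Crossing sets of a halting run *)

Lemma step_inv (Sigma : finType) (A : twoDFA Sigma) w (c c' : state A * nat) :
  step w c = Some c' ->
  (delta c.1 (tape_at w c.2) = Some (c'.1, Right) /\ c'.2 = c.2.+1) \/
  (delta c.1 (tape_at w c.2) = Some (c'.1, Left) /\ c.2 = c'.2.+1).
Proof.
case: c => q i; rewrite /step /=.
case: (delta q _) => [[r []]|] //.
  by case: i => // i [<-]; right.
by case: ifP => // _ [<-]; left.
Qed.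

Lemma tape_at_end (Sigma : Type) (w : seq Sigma) : tape_at w (size w).+1 = REnd.
Proof. by rewrite /= nth_default ?size_map. Qed.

(** The run halts at the right end-marker, so it never repeats a configuration. Hence it enters a
    given cell at most once in each state, and sets suffice to record the crossings. *)
Lemma crossing_sets (Sigma : finType) (A : twoDFA Sigma) w K qf :
  (forall q : state A, delta q LEnd = if q == q0 A then Some (q0 A, Right) else None) ->
  (forall q : state A, delta q REnd = None) ->
  @run Sigma A w K = Some (qf, (size w).+1) ->
  exists P R : nat -> {set state A},
    [/\ P 0 = [set q0 A], R 0 = set0, P (size w) = [set qf], R (size w) = set0 &
        forall p, p < size w ->
          crossing_step (fun q => delta q (tape_at w p.+1)) (P p) (R p) (P p.+1) (R p.+1)].
Proof.
move=> deltaL deltaR runK.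
pose T k := odflt (q0 A, 0) (run A w k).
have runE k : k <= K -> run A w k = Some (T k).
  move=> leKk; rewrite /T; case E: (run A w k) => //.
  have runN j : run A w (k + j) = None.
    by elim: j => [|j IH]; rewrite ?addn0 // addnS /run iterS -/(run A w (k + j)) IH.
  by have := runN (K - k); rewrite subnKC // runK.
have T0 : T 0 = (q0 A, 0) by [].
have TK : T K = (qf, (size w).+1) by rewrite /T runK.
have stepT k : k < K -> step w (T k) = Some (T k.+1).
  by move=> ltkK; rewrite -(runE k.+1) // /run iterS -/(run A w k) runE // ltnW.
have stepK : step w (T K) = None by rewrite TK /step tape_at_end deltaR.
(* Shifting a repetition at times [i < j] by [K - j] would give the halting configuration [T K] a
   successor. *)
have injT i j : i <= K -> j <= K -> T i = T j -> i = j.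
  wlog ltij : i j / i < j => [Hw|] lei lej Tij.
    case: (ltngtP i j) => // [lt|lt]; first exact: Hw.
    by apply/esym/Hw.
  have shift d : d <= K - j -> T (i + d) = T (j + d).
    elim: d => [|d IH] led; first by rewrite !addn0.
    apply: Some_inj; rewrite !addnS -!stepT; [|lia..].
    by rewrite IH // ltnW.
  have := shift (K - j) (leqnn _); rewrite subnKC // => E.
  have lt : i + (K - j) < K by lia.
  by have := stepT _ lt; rewrite E stepK.
pose P p := [set q | [exists k : 'I_K, ((T k).2 == p) && (T k.+1 == (q, p.+1))]].
pose R p := [set q | [exists k : 'I_K, ((T k).2 == p.+1) && (T k.+1 == (q, p))]].
have PP p q : reflect (exists2 k, k < K & (T k).2 = p /\ T k.+1 = (q, p.+1)) (q \in P p).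
  rewrite inE; apply: (iffP existsP) => [[k /andP[/eqP? /eqP?]]|[k ltk [E1 E2]]].
    by exists k.
  by exists (Ordinal ltk); rewrite E1 E2 !eqxx.
have RP p q : reflect (exists2 k, k < K & (T k).2 = p.+1 /\ T k.+1 = (q, p)) (q \in R p).
  rewrite inE; apply: (iffP existsP) => [[k /andP[/eqP? /eqP?]]|[k ltk [E1 E2]]].
    by exists k.
  by exists (Ordinal ltk); rewrite E1 E2 !eqxx.
have K_gt0 : 0 < K by case: (posnP K) TK => // ->; rewrite T0.
have visitP p q : p < size w ->
    reflect (exists2 k, k < K & T k = (q, p.+1)) (q \in P p :|: R p.+1).
  move=> ltp; rewrite inE; apply: (iffP orP).
    have ltS k : k < K -> T k.+1 = (q, p.+1) -> exists2 k, k < K & T k = (q, p.+1).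
      move=> ltk E; exists k.+1 => //; rewrite ltn_neqAle ltk andbT.
      by apply: contra_eqN E => /eqP ->; rewrite TK; apply/eqP; case; lia.
    by case=> [/PP|/RP] [k ltk [_ E]]; exact: ltS E.
  case=> -[|k] ltk E; first by rewrite T0 in E.
  have ltk' : k < K by exact: ltnW.
  case: (step_inv (stepT _ ltk')); rewrite E /= => -[_ e].
    by left; apply/PP; exists k => //; split=> //; case: e.
  by right; apply/RP; exists k.
(* The left end-marker lets only [q0 A] move, so a later visit would repeat the initial
   configuration. *)
have cell0 k : k < K -> (T k).2 = 0 -> k = 0.
  move=> ltk E; apply: injT; rewrite 1?ltnW // T0.
  case: (T k) (step_inv (stepT _ ltk)) E => q i /= H ei; move: H; rewrite ei /= deltaL.
  by case: eqP => [->|_] // [][].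
have T1 : T 1 = (q0 A, 1).
  case: (step_inv (stepT _ K_gt0)); rewrite T0 /= deltaL eqxx => -[] // [E1] E2.
  by case: (T 1) E1 E2 => ? ? /= <- <-.
exists P, R; split.
- apply/setP => q; rewrite in_set1; apply/PP/eqP => [[k ltk [E1 E2]]|->].
    by move: E2; rewrite (cell0 k ltk E1) T1 => -[].
  by exists 0.
- apply/setP => q; rewrite in_set0; apply/RP => -[k ltk [_ E]].
  have ltk1 : k.+1 < K.
    rewrite ltn_neqAle ltk andbT; apply: contra_eqN E => /eqP ->.
    by rewrite TK; apply/eqP; case.
  by have := cell0 _ ltk1; rewrite E => /(_ erefl).
- apply/setP => q; rewrite in_set1; apply/PP/eqP => [[k ltk [E1 E2]]|->].
    case: (ltngtP k.+1 K) => [lt||e]; [|lia|].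
      by have := stepT _ lt; rewrite E2 /step tape_at_end deltaR.
    by move: E2; rewrite e TK => -[].
  exists K.-1; first lia.
  rewrite prednK //; split=> //.
  have ltK1 : K.-1 < K by lia.
  have := step_inv (stepT _ ltK1); rewrite prednK // TK /= => -[] [E1 E2].
    by case: E2.
  move: E1; case: (T _) E2 => r i /= ->.
  by rewrite /= nth_default ?size_map ?deltaR.
- apply/setP => q; rewrite in_set0; apply/RP => -[k ltk [E1 E2]].
  by have := stepT _ ltk; case: (T k) E1 => r i /= ->; rewrite /= nth_default ?size_map // deltaR.
move=> p ltp; split.
- rewrite -setI_eq0; apply/eqP/setP => q; rewrite in_set0 in_setI; apply/andP => -[].
  case/PP=> k ltk [E1 E2] /RP[k' ltk' [E1' E2']].
  have [e] : k.+1 = k'.+1 by apply: injT; rewrite ?E2.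
  by move: E1'; rewrite -e E1; lia.
- move=> q1 q2 /(visitP _ _ ltp)[k1 lt1 E1] /(visitP _ _ ltp)[k2 lt2 E2] e.
  suff [ek] : k1.+1 = k2.+1 by move: E1; rewrite ek E2 => -[].
  apply: injT => //; apply: Some_inj; rewrite -!stepT // E1 E2.
  by rewrite /step e.
- move=> q /(visitP _ _ ltp)[k ltk E].
  by case: (step_inv (stepT _ ltk)); rewrite E /= => -[] ->.
- apply/setP => q; apply/RP/imsetP => [[k ltk [E1 E2]]|[r]].
    case: (step_inv (stepT _ ltk)); rewrite E1 E2 /=; first lia.
    case ETk: (T k) E1 => [r i] /= ei [E _]; exists r.
      rewrite inE; apply/andP; split; last by rewrite /exits_side /= E.
      by apply/visitP=> //; exists k; rewrite // ETk ei.
    by rewrite /target /= E.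
  rewrite inE => /andP[/(visitP _ _ ltp)[k ltk E] gr] ->.
  exists k => //; rewrite E; split=> //; move: (step_inv (stepT _ ltk)) gr.
  by rewrite E /exits_side /target /=; case: (T k.+1) => r' i /= [] [-> //] [->].
- apply/setP => q; apply/PP/imsetP => [[k ltk [E1 E2]]|[r]].
    case: (step_inv (stepT _ ltk)); rewrite E1 E2 /=; last lia.
    case ETk: (T k) E1 => [r i] /= ei [E _]; exists r.
      rewrite inE; apply/andP; split; last by rewrite /exits_side /= E.
      by apply/visitP=> //; exists k; rewrite // ETk ei.
    by rewrite /target /= E.
  rewrite inE => /andP[/(visitP _ _ ltp)[k ltk E] gr] ->.
  exists k => //; rewrite E; split=> //; move: (step_inv (stepT _ ltk)) gr.
  by rewrite E /exits_side /target /=; case: (T k.+1) => r' i /= [] [-> //] ->.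
Qed.

Definition letter (M : nat) : finType := ('I_M.+2 * {ffun 'I_M.+2 -> bool})%type.

(** * The automaton *)

(* In the letter (k, g), the states below k cross the cell unchanged, in the
   direction given by g; the state k turns back left as k + 1, and the last state
   moves right as k + 1, except that for k = M + 1 it moves right unchanged. *)
Definition counter_move (M : nat) (a : letter M) (q : 'I_M.+2) :
    option ('I_M.+2 * dir) :=
  let (k, g) := a in
  if q < k then Some (q, if g q then Right else Left)
  else if k == ord_max then Some (q, Right)
  else if q == k then Some (inord k.+1, Left)
  else if q == ord_max then Some (inord k.+1, Right)
  else None.

Definition counter (M : nat) : twoDFA (letter M) :=
  @TwoDFA (letter M) 'I_M.+2 ord0
    (fun q c => match c with
       | LEnd => if q == ord0 then Some (ord0, Right) else None
       | Sym a => counter_move a q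
       | REnd => None
       end)
    (pred1 ord_max).

(** * Lower bound by the potential *)

Fixpoint binary (d : nat -> nat) (m : nat) : nat :=
  if m is m'.+1 then (binary d m').*2 + d m' else 0.

Lemma binary_le d d' m : (forall y, y < m -> d y <= d' y) -> binary d m <= binary d' m.
Proof.
elim: m => //= m IH le_d; rewrite leq_add ?leq_double ?le_d //.
by apply: IH => y lt; apply/le_d/ltnW.
Qed.

(** Index 0 is the most significant. A rise by one at [c] is worth [2 ^ (m - 1 - c)], and drops at
    all later indices take back at least [2 ^ (m - 1 - c) - 1]. *)
Lemma binary_carry d d' m c : c < m ->
  (forall y, y < c -> d y <= d' y) -> d c <= (d' c).+1 ->
  (forall y, c < y < m -> d y < d' y) ->
  binary d m <= (binary d' m).+1.
Proof.
elim: m => //= m IH; rewrite ltnS leq_eqVlt => /predU1P[->|ltcm] le_lo le_c lt_hi.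
  by have := binary_le le_lo; lia.
have := IH ltcm le_lo le_c.
have := lt_hi m; rewrite ltcm ltnSn => /(_ isT) ? H.
suff : binary d m <= (binary d' m).+1 by lia.
by apply: H => y /andP[cy ym]; apply: lt_hi; rewrite cy ltnW.
Qed.

Section Potential.
Variable M : nat.
Implicit Types P R : {set 'I_M.+2}.

Definition below y P := #|[set q in P | q <= y]|.

(* Subtraction is truncated on purpose: an excess of rightward crossings counts
   as zero, so that it cannot be turned into a jump of the counter later on. *)
Definition digit P R y := (below y R).+1 - below y P.

(* Three consecutive boundaries of the shortest string have the same digits; the
   flag tells them apart. *)
Definition flag P R : nat := if ord_max \in P then (ord_max \notin R).+1 else 0.

Definition potential P R := 3 * binary (digit P R) M + flag P R.

Lemma below_set0 y : below y set0 = 0.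
Proof.
rewrite /below (_ : [set q in _ | _] = set0) ?cards0 //.
by apply/setP => q; rewrite in_set !in_set0.
Qed.

Lemma below_set1 y z : below y [set z] = (z <= y).
Proof.
rewrite /below; case: (leqP z y) => [le_zy|lt_yz].
  rewrite (_ : [set q in _ | _] = [set z]) ?cards1 //.
  by apply/setP => q; rewrite in_set in_set1; case: eqP => //= ->.
rewrite (_ : [set q in _ | _] = set0) ?cards0 //.
apply/setP => q; rewrite in_set in_set1 in_set0; case: eqP => //= ->.
by rewrite leqNgt lt_yz.
Qed.

Lemma potential_start : potential [set ord0] set0 = 0.
Proof.
have d0 y : digit [set ord0] set0 y = 0 by rewrite /digit below_set0 below_set1.
have v0 m : binary (digit [set ord0] set0) m = 0 by elim: m => //= m ->; rewrite d0.
by rewrite /potential v0 /flag in_set1.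
Qed.

Lemma potential_end : potential [set ord_max] set0 = 3 * 2 ^ M - 1.
Proof.
have d1 y : y < M -> digit [set ord_max] set0 y = 1.
  by move=> lt_yM; rewrite /digit below_set0 below_set1 /= leqNgt ltnS ltnW.
have v1 m : m <= M -> (binary (digit [set ord_max] set0) m).+1 = 2 ^ m.
  elim: m => // m IH lt_mM /=; rewrite d1 // addn1 expnS -IH ?(ltnW lt_mM) //.
  by rewrite mul2n doubleS.
rewrite /potential /flag in_set1 eqxx in_set0 /=; have := v1 M (leqnn M).
by move: (binary _ _) (2 ^ M) => a b <-; rewrite mulnS; lia.
Qed.

Lemma card_all_but_one (B : {set 'I_M.+2}) (Q : pred 'I_M.+2) z :
  {in B, forall q, Q q = (q != z)} -> #|[set q in B | Q q]| + (z \in B) = #|B|.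
Proof.
move=> QE; rewrite (cardsD1 z B) addnC; congr (_ + _).
apply: eq_card => q; rewrite !inE andbC.
by case qB: (q \in B); rewrite ?andbF // QE.
Qed.

(** For [k] equal to M + 1 or M the digits stay and only the flag can rise, by at most one. For
    smaller [k] the new flag is 0, so the binary part may grow only if the old flag is 2. *)
Lemma potential_step (a : letter M) P R P' R' :
  crossing_step (counter_move a) P R P' R' -> #|P| = #|R|.+1 ->
  potential P' R' <= (potential P R).+1.
Proof.
case: a => k g st bal; set mv := counter_move _ in st.
set D := P :|: R'.
have bin y : below y P + below y R' = #|[set q in D | q <= y]| by exact: (crossing_step_in st).
have bout y : below y R + below y P' = #|[set q in D | target mv q <= y]|.
  exact: (crossing_step_out st (fun q => q <= y)).
case: st => _ _ def_mv defR defP'.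
have PD q : q \in P -> q \in D by rewrite inE => ->.
have flagS (A B : {set 'I_M.+2}) : ord_max \notin A -> flag A B = 0.
  by move=> /negbTE; rewrite /flag => ->.
have flag2 : flag P' R' <= 2.
  by rewrite /flag; case: (ord_max \in P'); case: (ord_max \in R').
have [kmax|kNmax] := eqVneq k ord_max.
  have tgE q : target mv q = q.
    by rewrite /target /mv /counter_move kmax eqxx; case: ifP.
  have dE y : digit P' R' y = digit P R y.
    have := bout y; have := bin y; rewrite /digit.
    have -> : [set q in D | target mv q <= y] = [set q in D | q <= y].
      by apply/setP => q; rewrite !inE tgE.
    lia.
  have vE : binary (digit P' R') M <= binary (digit P R) M.
    by apply: binary_le => y _; rewrite dE.
  have maxR : ord_max \notin R.
    rewrite defR; apply/imsetP => -[q]; rewrite inE tgE => /andP[_ gq] eq.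
    by move: gq; rewrite -eq /exits_side /mv /counter_move kmax ltnn eqxx.
  rewrite /potential; case: (boolP (ord_max \in P)) => inP.
    by rewrite [flag P R]/flag inP maxR; lia.
  rewrite [flag P R]flagS //.
  suff : flag P' R' <= 1 by lia.
  rewrite /flag; case: ifP => //; rewrite defP' => /imsetP[q].
  rewrite inE tgE => /andP[qD _] eq; move: qD; rewrite -eq inE (negbTE inP) /= => ->.
  by [].
have ltk : k < M.+1.
  by rewrite ltn_neqAle -ltnS ltn_ord andbT (contra _ kNmax) // => /eqP e; apply/eqP/val_inj.
have k1E : (inord k.+1 : 'I_M.+2) = k.+1 :> nat by rewrite (@inordK M.+1).
have moves q : q \in D ->
    [\/ q < k /\ target mv q = q, q = k /\ mv q = Some (inord k.+1, Left)
       | q = ord_max /\ mv q = Some (inord k.+1, Right)].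
  move=> /def_mv; rewrite /target /mv /counter_move (negbTE kNmax).
  case: (ltnP q k) => _; first by constructor 1.
  case: eqVneq => [e|_]; first by constructor 2.
  by case: eqVneq => // e; constructor 3.
have tgt q : q \in D -> target mv q = (if q < k then q : nat else k.+1) :> nat.
  move=> /moves[[qk ->]|[-> e]|[-> e]]; first by rewrite qk.
    by rewrite /target e k1E ltnn.
  by rewrite /target e k1E ltnNge -ltnS ltn_ord.
have le_k q : q \in D -> q <= k \/ q = ord_max.
  by move=> /moves[[qk _]|[-> _]|[-> _]]; [left; apply: ltnW | left | right].
have low y : y < k -> digit P' R' y = digit P R y.
  move=> ltyk; have := bout y; have := bin y; rewrite /digit.
  suff -> : [set q in D | target mv q <= y] = [set q in D | q <= y] by lia.
  apply/setP => q; rewrite ![in LHS]in_set ![in RHS]in_set -!in_setU -/D.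
  case qD: (q \in D) => //=.
  rewrite tgt //; case: ltnP => // le_kq; lia.
have outD y : k < y -> #|[set q in D | target mv q <= y]| = #|D|.
  move=> ltky; congr #|pred_of_set _|; apply/setP => q; rewrite in_set andb_idr // => qD.
  by rewrite tgt //; case: ifP => // lt_qk; lia.
have inD y : k <= y <= M -> #|[set q in D | q <= y]| + (ord_max \in D) = #|D|.
  move=> leky; apply: card_all_but_one => q qD.
  by case: (le_k _ qD) => [|->]; rewrite -val_eqE /=; lia.
have inP y : k <= y <= M -> below y P + (ord_max \in P) = #|P|.
  move=> leky; apply: card_all_but_one => q /PD qD.
  by case: (le_k _ qD) => [|->]; rewrite -val_eqE /=; lia.
have atk : #|[set q in D | q <= k]| = (k \in D) + #|[set q in D | target mv q <= k]|.
  rewrite (cardsD1 k) in_set leqnn andbT; congr (_ + _).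
  congr #|pred_of_set _|; apply/setP => q; rewrite in_setD1 !in_set -in_setU -/D.
  case qD: (q \in D); rewrite ?andbF //=.
  by rewrite tgt // -val_eqE; case: ltnP => /= ?; case: (le_k _ qD) => [|->] /=; lia.
have inR r : r \in R -> r < k \/ r = inord k.+1 /\ k \in D.
  rewrite defR => /imsetP[q]; rewrite inE => /andP[qD gq] ->.
  case: (moves _ qD) => -[qk e]; first by left; rewrite e.
    by right; split; [rewrite /target e | rewrite -qk].
  by move: gq; rewrite /exits_side e.
have kR : k \in D -> inord k.+1 \in R.
  move=> kD; have mvk : mv k = Some (inord k.+1, Left).
    by rewrite /mv /counter_move ltnn (negbTE kNmax) eqxx.
  rewrite defR; apply/imsetP; exists k; last by rewrite /target mvk.
  by rewrite inE kD /exits_side mvk.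
have belowR y : k < y -> below y R = #|R|.
  move=> ltky; congr #|pred_of_set _|; apply/setP => r; rewrite in_set andb_idr //.
  by case/inR => [|[-> _]]; rewrite ?k1E //; lia.
have belowRk : k \in D -> (below k R).+1 = #|R|.
  move=> kD; rewrite -(@card_all_but_one R (fun q => q <= k) (inord k.+1)).
    by rewrite kR // addn1.
  by move=> r /inR[|[-> _]]; rewrite -val_eqE /= k1E; lia.
have [kM|kNM] := eqVneq (k : nat) M.
  have maxE : inord k.+1 = ord_max :> 'I_M.+2 by apply/val_inj; rewrite /= k1E kM.
  have vE : binary (digit P' R') M <= binary (digit P R) M.
    by apply: binary_le => y lty; rewrite low ?kM.
  rewrite /potential; case: (boolP (ord_max \in P)) => maxP.
    by rewrite [flag P R]/flag maxP; lia.
  rewrite [flag P R]flagS //.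
  suff : flag P' R' <= 1 by lia.
  rewrite /flag; case: ifP => //; rewrite defP' => /imsetP[q].
  rewrite inE => /andP[qD gq] eq.
  suff qmax : q = ord_max by move: qD; rewrite qmax inE (negbTE maxP) /= => ->.
  case: (moves _ qD) => -[qk e] //; first by rewrite eq.
  by move: gq; rewrite /exits_side e.
have ltkM : k < M by rewrite ltn_neqAle kNM -ltnS.
have maxR : ord_max \notin R.
  by apply/negP => /inR[|[/(congr1 val)]]; rewrite ?k1E /=; lia.
have -> : potential P' R' = 3 * binary (digit P' R') M.
  rewrite /potential flagS ?addn0 // defP'; apply/imsetP => -[q].
  rewrite inE => /andP[qD _] eq; have := tgt q qD.
  by rewrite -eq /=; case: ltnP => lt_qk; lia.
(* For [y > k] all targets are at most [y], so that digit cannot grow; growth at [k] itself needs a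
   visit in state [k]. *)
case kD: (k \in D); last first.
  suff : binary (digit P' R') M <= binary (digit P R) M by rewrite /potential; lia.
  apply: binary_le => y lty; have := bin y; have := bout y; rewrite /digit.
  case: (ltngtP y k) => [ltyk|ltky|->]; first by move: (low _ ltyk); rewrite /digit; lia.
    by rewrite outD //; have := inD y; lia.
  by rewrite atk kD; lia.
have digk : digit P' R' k <= (digit P R k).+1.
  have := bin k; have := bout k; rewrite /digit atk kD; lia.
(* The old flag is 2 here, which pays for a carry into digit [k]. By the balance [bal], the digits
   strictly between [k] and [M] are 1 before the cell and 0 after it. *)
case maxP: (ord_max \in P).
  suff : binary (digit P' R') M <= (binary (digit P R) M).+1.
    by rewrite /potential /flag maxP maxR; lia.
  apply: (binary_carry ltkM) => // [y ltyk|y /andP[ltky ltyM]]; first by rewrite low.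
  have maxD : ord_max \in D by apply: PD.
  have := bin y; have := bout y; rewrite /digit outD // belowR //.
  by have := inD y; have := inP y; rewrite maxD maxP; lia.
(* Now all of [P] is at most [k], while [inord k.+1] is in [R]: without truncation the digit at [k]
   would go from -1 to 0. *)
suff : binary (digit P' R') M <= binary (digit P R) M by rewrite /potential; lia.
apply: binary_le => y lty; case: (ltngtP y k) => [ltyk|ltky|->]; first by rewrite low.
  have := bin y; have := bout y; rewrite /digit outD // belowR //.
  by have := inD y; lia.
have := bin k; have := bout k; rewrite /digit atk kD.
by have := inP k; have := belowRk kD; rewrite maxP; lia.
Qed.

End Potential.

Lemma counter_size_ge M w : accepts (counter M) w -> 3 * 2 ^ M - 1 <= size w.
Proof.
case=> K [qf [runK /eqP qfE]]; rewrite {}qfE in runK.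
have [//|//|P [R [P0 R0 Pw Rw st]]] := crossing_sets _ _ runK.
suff H p : p <= size w -> #|P p| = #|R p|.+1 /\ potential (P p) (R p) <= p.
  by rewrite -(potential_end M); have [_] := H _ (leqnn _); rewrite Pw Rw.
elim: p => [_|p IH ltp]; first by rewrite P0 R0 cards1 cards0 potential_start.
have [bal le_p] := IH (ltnW ltp); move: (st _ ltp).
have -> : tape_at w p.+1 = Sym (nth (ord0, [ffun=> false]) w p).
  by rewrite /= (nth_map (ord0, [ffun=> false])).
move=> stp; split; first exact: crossing_step_balance stp bal.
exact: leq_trans (potential_step stp bal) _.
Qed.

(** * Runs on growing prefixes of the tape *)

Section Exits.
Variables (Sigma : finType) (A : twoDFA Sigma).

(** A complete excursion from cell [p] up to the first crossing into cell [p.+1]. It reads only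
    cells up to [p], so it survives when the word grows. *)
Inductive exits (t : nat -> tsym Sigma) : nat -> state A -> state A -> Prop :=
| exits_right p q q' : delta q (t p) = Some (q', Right) -> exits t p q q'
| exits_left p q r r' q' : delta q (t p.+1) = Some (r, Left) ->
    exits t p r r' -> exits t p.+1 r' q' -> exits t p.+1 q q'.

Inductive arrives (t : nat -> tsym Sigma) : nat -> state A -> Prop :=
| arrives0 q : exits t 0 (q0 A) q -> arrives t 0 q
| arrivesS p r q : arrives t p r -> exits t p.+1 r q -> arrives t p.+1 q.

Definition crosses t p (o : option (state A)) q :=
  if o is Some r then exits t p r q else arrives t p q.

Lemma exits_eq t t' p q q' :
  (forall i, i <= p -> t i = t' i) -> exits t p q q' -> exits t' p q q'.
Proof.
move=> eqt E; elim: E eqt => {p q q'} [p q q' d|p q r r' q' d _ IH1 _ IH2] eqt.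
  by apply: exits_right; rewrite -eqt.
apply: (@exits_left _ _ _ r r'); [by rewrite -eqt | apply: IH1 | exact: IH2].
by move=> i lei; apply: eqt; rewrite leqW.
Qed.

Lemma arrives_eq t t' p q :
  (forall i, i <= p -> t i = t' i) -> arrives t p q -> arrives t' p q.
Proof.
move=> eqt E; elim: E eqt => {p q} [q E|p r q _ IH E] eqt.
  by apply/arrives0/(exits_eq _ E).
apply: (@arrivesS _ _ r); last exact: exits_eq E.
by apply: IH => i lei; apply: eqt; rewrite leqW.
Qed.

Lemma crosses_eq t t' p o q :
  (forall i, i <= p -> t i = t' i) -> crosses t p o q -> crosses t' p o q.
Proof. by case: o => [r|]; [exact: exits_eq | exact: arrives_eq]. Qed.

Lemma crosses_trans t p o q q' :
  (forall r, o = Some r -> delta r (t p.+1) = Some (r, Left)) ->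
  crosses t p o q -> exits t p.+1 q q' -> crosses t p.+1 o q'.
Proof.
case: o => [r|] /= back E1 E2; last exact: arrivesS E1 E2.
exact: exits_left (back _ erefl) E1 E2.
Qed.

Definition run_from w k (c : state A * nat) :=
  iter k (fun oc => if oc is Some c then step w c else None) (Some c).

Lemma run_from_add w j k c c' : run_from w j c = Some c' ->
  run_from w (k + j) c = run_from w k c'.
Proof. by move=> E; rewrite /run_from iterD -/(run_from w j c) E. Qed.

Lemma exits_run w p q q' : p <= size w -> exits (tape_at w) p q q' ->
  exists k, run_from w k (q, p) = Some (q', p.+1).
Proof.
move=> lep E; elim: E lep => {p q q'} [p q q' d|p q r r' q' d _ IH1 _ IH2] lep.
  by exists 1; rewrite /run_from /= d ltnS lep.
have [k1 E1] := IH1 (ltnW lep); have [k2 E2] := IH2 lep.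
exists (k2 + (k1 + 1)); rewrite (run_from_add _ (c' := (r', p.+1))) //.
by rewrite (run_from_add _ (c' := (r, p))) // /run_from /= d.
Qed.

Lemma arrives_run w p q : p <= size w -> arrives (tape_at w) p q ->
  exists k, run A w k = Some (q, p.+1).
Proof.
move=> lep E; elim: E lep => {p q} [q E|p r q _ IH E] lep; first exact: exits_run E.
have [k1 E1] := IH (ltnW lep); have [k2 E2] := exits_run lep E.
by exists (k2 + k1); rewrite -E2; apply: run_from_add.
Qed.

End Exits.

(** * Crossing sequences along the shortest string *)

Section Words.
Variable M : nat.
Local Notation S := 'I_M.+2.
Implicit Types W V : seq (option S * S).

(* A word [:: (Some r_m, t_m); ...; (Some r_1, t_1); (None, t_0)] stands for the
   crossing sequence t_0, r_1, t_1, ..., r_m, t_m of a boundary: t_0 is the state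
   of the first arrival, and an entry from the right in r_i comes back in t_i. *)
Fixpoint valid W : bool :=
  if W is (o, t) :: V then
    match o, V with
    | None, [::] => true
    | Some r, (_, a) :: _ =>
        [&& a < r, (r < t) || (r == ord_max) && (t == ord_max) & valid V]
    | _, _ => false
    end
  else false.

Lemma valid_cons r t o a V : valid ((Some r, t) :: (o, a) :: V) =
  [&& a < r, (r < t) || (r == ord_max) && (t == ord_max) & valid ((o, a) :: V)].
Proof. by []. Qed.

(** The weights count the continuations of a crossing sequence whose next term is at least [y]:
    [weightP] at an odd place, [weightR] at an even place with the empty continuation included.
    Hence [3 * 2 ^ M + sumR W - sumP W] sequences precede [W]. *)
Definition weightP (y : nat) := if y == M.+1 then 1 else 3 * 2 ^ (M - y).
Definition weightR (y : nat) := if y == M.+1 then 2 else 3 * 2 ^ (M - y).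

Lemma weightP_max : weightP M.+1 = 1.
Proof. by rewrite /weightP eqxx. Qed.

Lemma weightR_max : weightR M.+1 = 2.
Proof. by rewrite /weightR eqxx. Qed.

Lemma weightP_gt0 y : 0 < weightP y.
Proof. by rewrite /weightP; case: ifP => // _; rewrite muln_gt0 expn_gt0. Qed.

(** Split by whether the next term is [y]; if it is, the rest starts from [y.+1] at a place of the
    other parity. *)
Lemma weight_split y : y <= M ->
  weightP y = weightP y.+1 + weightR y.+1 /\ weightR y = weightP y.+1 + weightR y.+1.
Proof.
move=> leyM; rewrite /weightP /weightR ltn_eqF // eqSS.
case: (eqVneq y M) => [->|neq]; first by rewrite subnn.
have -> : M - y = (M - y.+1).+1 by lia.
by rewrite expnS; lia.
Qed.

Definition sumP W := sumn [seq weightP c.2 | c : option S * S <- W].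
Definition sumR W := sumn [seq (if c.1 is Some r then weightR r else 0) | c : option S * S <- W].

Lemma valid_top o a W c : valid ((o, a) :: W) -> c \in (o, a) :: W ->
  c.2 <= a /\ (forall r, c.1 = Some r -> r <= a).
Proof.
elim: W o a => [|[o' a'] W IH] [r|] a //=.
  by move=> _; rewrite inE => /eqP -> /=; split.
case/and3P=> lt_a'r lera vW; rewrite inE => /predU1P[->|cW] /=.
  by split=> // _ [<-]; case/orP: lera => [/ltnW//|/andP[/eqP-> /eqP->]].
have [le1 le2] := IH o' a' vW cW.
have lea : a' <= a by case/orP: lera => [|/andP[_ /eqP->]]; [lia | exact: leq_ord].
by split=> [|s /le2 le3]; apply: leq_trans lea.
Qed.

Lemma valid_tail o a V c : valid ((o, a) :: V) -> c \in V ->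
  c.2 < a /\ (forall s, c.1 = Some s -> s < a).
Proof.
move=> vV cV; case: V vV cV => [|[o1 a1] V] //; case: o => // r vV cV.
have [_ /(_ r erefl) lera] := valid_top vV (mem_head _ _).
case/and3P: vV => lt_a1r _ vV; have [le1 le2] := valid_top vV cV.
by split=> [|s /le2 le3]; lia.
Qed.

(** Needed for [word_letter]: since no state below [ord_max] crosses a boundary both ways, one [g]
    can serve all the states to be kept. *)
Lemma valid_parity W o q q' : valid W -> (o, q) \in W -> (Some q, q') \in W -> q = ord_max.
Proof.
elim: W => [|[[r|] t] [|[o1 a1] W] IH] //=.
  case/and3P=> lt_a1r lert vW.
  have top c := @valid_top o1 a1 W c vW.
  rewrite in_cons => /predU1P[[_ ->]|cW]; rewrite in_cons => /predU1P[[e e']|cW'].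
  - by case/orP: lert => [|/andP[_ /eqP//]]; rewrite -e ltnn.
  - by have [_ /(_ _ erefl)] := top _ cW'; case/orP: lert => [|/andP[_ /eqP->]] //; lia.
  - by have [/= ] := top _ cW; rewrite e; lia.
  - exact: IH vW cW cW'.
Qed.

Definition realized (t : nat -> tsym (letter M)) p W :=
  forall o q, (o, q) \in W -> @crosses _ (counter M) t p o q.

Definition word_letter (k : S) W : letter M :=
  (k, [ffun q => Some q \notin [seq c.1 | c <- W]]).

Lemma crosses_keep t p k W o q :
  t p.+1 = Sym (word_letter k W) -> valid W -> (o, q) \in W -> q < k ->
  (forall r, o = Some r -> r < k) ->
  @crosses _ (counter M) t p o q -> @crosses _ (counter M) t p.+1 o q.
Proof.
move=> tp vW oqW ltqk ltok cr.
apply: (@crosses_trans _ (counter M) t p o q q _ cr) => [r ro|].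
  rewrite tp /= ltok // ffunE -ro.
  by have -> : o \in [seq c.1 | c <- W] by apply/mapP; exists (o, q).
apply: exits_right; rewrite tp /= ltqk ffunE; case: mapP => //= -[[o' q'] oqW' e].
move: oqW'; rewrite -[o']/((o', q').1) -e => oqW'.
have qmax := valid_parity vW oqW oqW'.
by move: ltqk; rewrite qmax /=; have := ltn_ord k; lia.
Qed.

(** The successor in the order: if the last term is not [ord_max], append [ord_max] twice. Otherwise
    the final terms a, b, [ord_max] become a, b - 1, b if a + 1 < b, and just b if a + 1 = b. The
    equation says that the rank grows by one. *)
Lemma next_word W : valid W -> W <> [:: (None, ord_max)] ->
  exists (a : letter M) W',
    [/\ valid W', sumP W' + sumR W + 1 = sumR W' + sumP W &
        forall t p, t p.+1 = Sym a -> realized t p W -> realized t p.+1 W'].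
Proof.
case: W => // -[o a] V vW Wend.
have [amax|aNmax] := eqVneq a ord_max; last first.
  have lta : a < M.+1.
    by rewrite ltn_neqAle -ltnS ltn_ord andbT (contra _ aNmax) // => /eqP e; apply/eqP/val_inj.
  exists (word_letter ord_max ((o, a) :: V)), ((Some ord_max, ord_max) :: (o, a) :: V).
  split; first by rewrite valid_cons vW lta !eqxx orbT.
    by rewrite /sumP /sumR /= weightP_max weightR_max; lia.
  move=> t p tp reW o' q; rewrite in_cons => /predU1P[[-> ->]|cW].
    by apply: exits_right; rewrite tp /= ltnn eqxx.
  have [le1 le2] := valid_top vW cW.
  apply: crosses_keep tp vW cW _ _ (reW _ _ cW) => [|r ro] /=; first by move: le1 => /=; lia.
  by have := le2 _ ro; lia.
rewrite {a}amax in vW Wend *.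
case: o vW Wend => [b|]; last by case: V.
case: V => // -[o a] V vW _.
have {vW} [lt_ab vV] : a < b /\ valid ((o, a) :: V) by move: vW => /= /and3P[].
have leb : b <= M.+1 by rewrite -ltnS.
set W := (Some b, ord_max) :: _.
have vW : valid W by rewrite valid_cons lt_ab vV eqxx !andbT -val_eqE /=; lia.
(* The state [k] turns back left as [b], returns as [ord_max] by the first entry of [W], and then
   leaves right as [b]. *)
have turn (k : S) t p : k.+1 = b -> t p.+1 = Sym (word_letter k W) -> realized t p W ->
    @exits _ (counter M) t p.+1 k b.
  move=> k1 tp reW.
  have kNmax : k == ord_max = false by rewrite -val_eqE /=; lia.
  have k1b : inord k.+1 = b by rewrite k1 inord_val.
  apply: (@exits_left _ (counter M) _ _ _ b ord_max).
  - by rewrite tp /= ltnn kNmax eqxx k1b.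
  - by apply: (reW (Some b)); rewrite inE eqxx.
  - apply: exits_right; rewrite tp /= ltnNge -ltnS ltn_ord kNmax eqxx k1b.
    by rewrite eq_sym kNmax.
have [lt_a1b|le_ba1] := ltnP a.+1 b.
  have k1 : (inord b.-1 : S).+1 = b by rewrite inordK; lia.
  exists (word_letter (inord b.-1) W), ((Some (inord b.-1), b) :: (o, a) :: V).
  split.
  - by rewrite valid_cons vV andbT; apply/andP; split; [|apply/orP; left]; lia.
  - have := @weight_split (inord b.-1 : S); rewrite k1.
    rewrite /sumP /sumR /= weightP_max; have := ltn_ord (inord b.-1 : S).
    move: (weightP b) (weightR b) (weightR (inord b.-1 : S)) => *; lia.
  - move=> t p tp reW o' q; rewrite in_cons => /predU1P[[-> ->]|cV]; first exact: turn tp reW.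
    have cW : (o', q) \in W by rewrite in_cons cV orbT.
    have [le1 le2] := valid_top vV cV.
    apply: crosses_keep tp vW cW _ _ (reW _ _ cW) => [|r ro]; first by move: le1 => /=; lia.
    by have := le2 _ ro; lia.
have a1 : a.+1 = b by lia.
exists (word_letter a W), ((o, b) :: V); split.
- move: vV => /=; case: (o) => [r|] //; case: (V) => // -[o2 a2] V2.
  case/and3P=> -> /orP[lt_ra|/andP[_ /eqP amax]] -> //.
    by rewrite andbT; apply/orP; left; lia.
  by move: a1 leb; rewrite amax /=; lia.
- have := @weight_split a; rewrite a1.
  rewrite /sumP /sumR /= weightP_max.
  by move: (weightP b) (weightR b) (weightP a) => *; lia.
- move=> t p tp reW o' q; rewrite in_cons => /predU1P[[-> ->]|cV].
    have oaW : (o, a) \in W by rewrite !in_cons eqxx orbT.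
    apply: (@crosses_trans _ (counter M) _ _ _ _ _ _ (reW _ _ oaW) (turn a _ _ a1 tp reW)) => r ro.
    have rW : Some r \in [seq c.1 | c <- W] by apply/mapP; exists (o, a).
    have ltra : r < a.
      move: vV lt_ab leb; rewrite ro /=; case: (V) => // -[o1 a2] V1.
      by case/and3P=> _ /orP[|/andP[_ /eqP->]] //=; lia.
    by rewrite tp /= ltra ffunE rW.
  have cW : (o', q) \in W by rewrite !in_cons cV !orbT.
  have [lt1 lt2] := valid_tail vV cV.
  exact: crosses_keep tp vW cW lt1 lt2 (reW _ _ cW).
Qed.

Lemma weight_lt a r : a < r <= M.+1 -> weightR r < weightP a.
Proof.
case/andP=> lt_ar le_r; rewrite /weightP /weightR (_ : a == M.+1 = false); last by lia.
case: eqVneq => [_|neq]; first by have := expn_gt0 2 (M - a); lia.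
by rewrite ltn_pmul2l // ltn_exp2l //; lia.
Qed.

(** Each leftward term is paired with the smaller rightward term just before it in time, which
    weighs strictly more by [weight_lt]. *)
Lemma valid_weight o a V :
  valid ((o, a) :: V) -> sumR ((o, a) :: V) + size V <= sumP V.
Proof.
elim: V o a => [|[o1 a1] V IH] [r|] a //; rewrite valid_cons => /and3P[lt_a1r _ vV].
have := IH _ _ vV; have := @weight_lt a1 r; rewrite lt_a1r leq_ord => /(_ isT).
by rewrite /sumR /sumP /=; lia.
Qed.

(** The surplus from [valid_weight] and the positive weight of [a] leave no room for a second
    entry. *)
Lemma valid_end W : valid W -> sumP W = (sumR W).+1 -> W = [:: (None, ord_max)].
Proof.
case: W => // -[o a] V vW; have := valid_weight vW.
have -> : sumP ((o, a) :: V) = weightP a + sumP V by [].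
move=> leV eqW.
have V0 : V = [::] by apply: size0nil; have := weightP_gt0 a; lia.
move: vW eqW; rewrite {}V0; case: o leV => // _ _; rewrite /sumP /sumR /= /weightP.
case: eqP => [aE _|_ e]; last by exfalso; lia.
by congr [:: (_, _)]; apply/val_inj.
Qed.

Lemma counter_words k : k <= 3 * 2 ^ M - 1 -> exists u W,
  [/\ size u = k, valid W, k + sumP W = 3 * 2 ^ M + sumR W & realized (tape_at u) k W].
Proof.
elim: k => [_|k IH ltk].
  exists [::], [:: (None, ord0)]; split=> // [|o q].
    by rewrite /sumP /sumR /= /weightP /= subn0; lia.
  rewrite inE => /eqP[-> ->]; apply/arrives0/exits_right => /=.
  by [].
have [u [W [szu vW eqW reW]]] := IH (ltnW ltk).
have [|a [W' [vW' eqW' reW']]] := next_word vW.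
  (* The final word has rank [3 * 2 ^ M - 1], which [ltk] excludes. *)
  by move=> WE; move: eqW; rewrite WE /sumP /sumR /= weightP_max; lia.
exists (rcons u a), W'; split=> //; first by rewrite size_rcons szu.
  by lia.
apply: reW'; first by rewrite /= map_rcons nth_rcons size_map szu ltnn eqxx.
move=> o q oqW; apply: crosses_eq (reW _ _ oqW) => -[|i] // lti.
by rewrite /= map_rcons nth_rcons size_map szu lti.
Qed.

Lemma counter_accepts : exists w, accepts (counter M) w /\ size w = 3 * 2 ^ M - 1.
Proof.
have [u [W [szu vW eqW reW]]] := counter_words (leqnn _).
exists u; split=> //; have WE : W = [:: (None, ord_max)].
  by apply: valid_end => //; have := expn_gt0 2 M; lia.
have /arrives_run : @arrives _ (counter M) (tape_at u) (size u) ord_max.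
  by rewrite szu; apply: (reW None); rewrite WE mem_head.
by case=> // k runk; exists k, ord_max; split=> //=; apply: eqxx.
Qed.

End Words.

Theorem theorem4 :
  forall n : nat, 2 <= n ->
  exists (Sigma : finType) (A : twoDFA Sigma),
    nstates A = n /\
    (exists w : seq Sigma, accepts A w /\ size w = 3 * 2 ^ (n - 2) - 1) /\
    (forall w : seq Sigma, accepts A w -> 3 * 2 ^ (n - 2) - 1 <= size w).
Proof.
case=> [|[|M]] // _; exists (letter M), (counter M); rewrite -addn2 addnK.
split; first by rewrite /nstates card_ord addn2.
by split; [exact: counter_accepts | exact: counter_size_ge].
Qed.
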